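(* Let $\theta=\frac{1+i\sqrt7}{2}$ and $\Gamma=\langle A,B\rangle\subset\mathrm{PSL}_2(\mathbb{Z}[\theta])$ with $A=\begin{pmatrix}1&1\\0&1\end{pmatrix}$, $B=\begin{pmatrix}1&0\\ \theta&1\end{pmatrix}$. If $X,Y\in\Gamma$ satisfy $\Gamma=\langle X,Y\rangle$ and $\mathrm{tr}\,X=\mathrm{tr}\,Y$, then $X$ and $Y$ are parabolic.
   Context: $\Gamma$ is the image of the discrete faithful representation of the fundamental group of the complement of the two-bridge link $6^2_3$ in $S^3$; it is a finite-covolume Kleinian group with traces in $\mathbb{Z}[\theta]$, the ring of integers of its trace field $\mathbb{Q}(\theta)$. Traces are taken of lifts to $\mathrm{SL}_2\mathbb{C}$; ''$\mathrm{tr}\,X=\mathrm{tr}\,Y$'' means the elements admit lifts of equal trace. Parabolic means non-identity with $\mathrm{tr}^2=4$. *)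

(* Defs.v *)
From HB Require Import structures.
From mathcomp Require Import all_boot all_order all_algebra all_field.
Set Implicit Arguments. Unset Strict Implicit. Unset Printing Implicit Defensive.
Import Order.TTheory GRing.Theory Num.Theory.
Local Open Scope ring_scope.

Definition theta : algC := (1 + sqrtC (-7)) / 2.

Definition Amat : 'M[algC]_2 := 1%:M + delta_mx 0 1.
Definition Bmat : 'M[algC]_2 := 1%:M + theta *: delta_mx 1 0.

(* Subgroup of GL_2(algC) generated by a set S (all matrices considered here
   lie in SL_2, so invmx is the group inverse). *)
Inductive gen (S : 'M[algC]_2 -> Prop) : 'M[algC]_2 -> Prop :=
| gen_base M : S M -> gen S M
| gen_one : gen S 1%:M
| gen_mul M N : gen S M -> gen S N -> gen S (M *m N)
| gen_inv M : gen S M -> gen S (invmx M).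

(* Preimage in SL_2 of the subgroup of PSL_2 generated by the classes of X, Y:
   the subgroup of SL_2 generated by X, Y and -I. *)
Definition genPSL (X Y : 'M[algC]_2) : 'M[algC]_2 -> Prop :=
  gen (fun M => M = X \/ M = Y \/ M = - 1%:M).

Definition Gamma : 'M[algC]_2 -> Prop := genPSL Amat Bmat.

(* Parabolic element of PSL_2, given by a lift X in SL_2:
   non-identity (X <> +-I) and tr^2 = 4. *)
Definition parabolic (X : 'M[algC]_2) : Prop :=
  X <> 1%:M /\ X <> - 1%:M /\ (\tr X) ^+ 2 = 4.

(* Main.v *)
(** If [X] and [Y] generate the group then every commutator [PQ - QP] of its
    elements lies in [M_2(Z[theta]) (XY - YX)]: this uses [CX = (tr X - X) C] for
    [C = XY - YX].  Applied to the two generating pairs, it shows that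
    [det (XY - YX)] and [det (AB - BA) = - theta^2] agree up to a unit.  With
    [x = tr X = tr Y] and [z = tr XY], [det (XY - YX) = - (z - 2) (z + 2 - x^2)],
    so [u = z - 2] and [v = z + 2 - x^2] have product [+- theta^2] and
    [x^2 = 4 + u - v].  Running through the factorizations, [4] is the only
    square that arises. *)
Require Import Defs.
From HB Require Import structures.
From mathcomp Require Import all_boot all_order all_algebra all_field.
From mathcomp Require Import ring zify.
Import Order.TTheory GRing.Theory Num.Theory.
Local Open Scope ring_scope.

(** * Arithmetic of [Z[theta]] in integer coordinates *)

Definition is_Ztheta (x : algC) : Prop :=
  exists a b : int, x = a%:~R + b%:~R * theta.

Lemma theta_sqr : theta ^+ 2 = theta - 2.
Proof.
have h : sqrtC (-7) ^+ 2 = -7 :> algC by exact: sqrtCK.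
rewrite /theta; set s := sqrtC _ in h *.
have -> : ((1 + s) / 2) ^+ 2 = (1 + 2 * s + s ^+ 2) / 4 by field.
by rewrite h; field.
Qed.

(** The form is the norm of [a + b theta]. Four times it equals [(2a + b)^2 + 7b^2], so it is
    positive definite. *)
Lemma norm_eq0 (a b : int) : a ^+ 2 + a * b + 2 * b ^+ 2 = 0 -> a = 0 /\ b = 0.
Proof. by move=> h; split; nia. Qed.

Lemma norm_ge0 (a b : int) : 0 <= a ^+ 2 + a * b + 2 * b ^+ 2.
Proof. by nia. Qed.

Lemma factor_bounds (m n k : int) : 0 <= m -> 0 <= n -> m * n = k -> 0 < k ->
  0 < m <= k.
Proof.
move=> hm hn h hk.
have h1 : m != 0 by apply/eqP => e; rewrite e mul0r in h; rewrite -h in hk.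
have h2 : n != 0 by apply/eqP => e; rewrite e mulr0 in h; rewrite -h in hk.
by nia.
Qed.

(** Completing the square gives [7b^2 <= 16]. The bound [4] is the norm of [theta^2], whose
    factorizations are enumerated below. *)
Lemma norm_le4 (a b : int) : a ^+ 2 + a * b + 2 * b ^+ 2 <= 4 ->
  (-1 <= b <= 1) /\ (-2 <= a <= 2).
Proof.
move=> h.
have hb : -1 <= b <= 1 by nia.
have [|[]] : b = -1 \/ b = 0 \/ b = 1 by lia.
all: by move=> hb'; rewrite hb' in h *; split=> //; nia.
Qed.

Lemma norm_eq1 (a b : int) : a ^+ 2 + a * b + 2 * b ^+ 2 = 1 ->
  b = 0 /\ (a = 1 \/ a = -1).
Proof.
move=> h; have [hb ha] : (-1 <= b <= 1) /\ (-2 <= a <= 2).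
  by apply: norm_le4; rewrite h.
have hb' : b = -1 \/ b = 0 \/ b = 1 by lia.
have ha' : a = -2 \/ a = -1 \/ a = 0 \/ a = 1 \/ a = 2 by lia.
clear ha hb.
by case: hb' => [|[]] hb; subst b; case: ha' => [|[|[|[]]]] ha; subst a; lia.
Qed.

Lemma Ztheta_inj (a b c d : int) :
  a%:~R + b%:~R * theta = c%:~R + d%:~R * theta -> a = c /\ b = d.
Proof.
move=> h.
have e0 : (a - c)%:~R + (b - d)%:~R * theta = 0.
  by rewrite !rmorphB /=; move/eqP: h; rewrite -subr_eq0 => /eqP <-; ring.
suff /norm_eq0 [] : (a - c) ^+ 2 + (a - c) * (b - d) + 2 * (b - d) ^+ 2 = 0.
  by move=> /eqP; rewrite subr_eq0 => /eqP -> /eqP; rewrite subr_eq0 => /eqP ->.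
apply/eqP; rewrite -(intr_eq0 algC); apply/eqP.
move: (a - c) (b - d) e0 => p q e0.
(* The second factor is the conjugate of the first: [1 - theta] is conjugate to [theta], with
   [theta (1 - theta) = 2]. *)
transitivity ((p%:~R + q%:~R * theta) * (p%:~R + q%:~R * (1 - theta))); last first.
  by rewrite e0 mul0r.
transitivity (p%:~R ^+ 2 + p%:~R * q%:~R + q%:~R ^+ 2 * (theta - theta ^+ 2)).
  by rewrite theta_sqr; ring.
by ring.
Qed.

Lemma Ztheta_int (a : int) : is_Ztheta a%:~R.
Proof. by exists a, 0; rewrite mul0r addr0. Qed.

Lemma Ztheta_theta : is_Ztheta theta.
Proof. by exists 0, 1; rewrite mul1r add0r. Qed.

Lemma Ztheta_add x y : is_Ztheta x -> is_Ztheta y -> is_Ztheta (x + y).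
Proof. by move=> [a [b ->]] [c [d ->]]; exists (a + c), (b + d); ring. Qed.

Lemma Ztheta_opp x : is_Ztheta x -> is_Ztheta (- x).
Proof. by move=> [a [b ->]]; exists (- a), (- b); ring. Qed.

Lemma Ztheta_mul_coord (a b c d : int) :
  (a%:~R + b%:~R * theta) * (c%:~R + d%:~R * theta) =
  (a * c - 2 * b * d)%:~R + (a * d + b * c + b * d)%:~R * theta.
Proof.
transitivity (a%:~R * c%:~R + (a%:~R * d%:~R + b%:~R * c%:~R) * theta
  + b%:~R * d%:~R * theta ^+ 2); first by ring.
by rewrite theta_sqr; ring.
Qed.

Lemma Ztheta_mul x y : is_Ztheta x -> is_Ztheta y -> is_Ztheta (x * y).
Proof.
move=> [a [b ->]] [c [d ->]]; rewrite Ztheta_mul_coord.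
by exists (a * c - 2 * b * d), (a * d + b * c + b * d).
Qed.

(** The norm is multiplicative with nonnegative integer values, so a unit has norm [1]. *)
Lemma Ztheta_unit x y : is_Ztheta x -> is_Ztheta y -> x * y = 1 ->
  x = 1 \/ x = -1.
Proof.
move=> [a [b ->]] [c [d ->]]; rewrite Ztheta_mul_coord => h.
have [h1 h2] : a * c - 2 * b * d = 1 /\ a * d + b * c + b * d = 0.
  by apply: Ztheta_inj; rewrite h mul0r addr0.
have hN : (a ^+ 2 + a * b + 2 * b ^+ 2) * (c ^+ 2 + c * d + 2 * d ^+ 2) = 1.
  transitivity ((a * c - 2 * b * d) ^+ 2
    + (a * c - 2 * b * d) * (a * d + b * c + b * d)
    + 2 * (a * d + b * c + b * d) ^+ 2); first by ring.
  by rewrite h1 h2.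
have hN1 : a ^+ 2 + a * b + 2 * b ^+ 2 = 1.
  by have := factor_bounds _ _ _ (norm_ge0 a b) (norm_ge0 c d) hN isT; lia.
have [-> [->|->]] := norm_eq1 _ _ hN1; [left|right]; ring.
Qed.

(** * Squares of the form [4 + u - v] with [uv = theta^2] or [uv = - theta^2] *)

Lemma divisor_bounds (m n d e : int) : m * n = d -> (d = e \/ d = - e) ->
  0 < e -> - e <= m <= e.
Proof.
move=> h de e0.
have hm : m != 0 by apply/eqP => m0; rewrite m0 mul0r in h; lia.
have hn : n != 0 by apply/eqP => n0; rewrite n0 mulr0 in h; lia.
by nia.
Qed.

(** The two equations say [(m + n theta)^2 = c + d theta]. The listed pairs are the values of
    [4 + u - v] when [u] and [v] are both [theta] up to sign, or are [1] and [theta^2] up to sign in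
    some order. Since [n (2m + n) = d], a nonzero [d] leaves finitely many [n]. *)
Lemma square_coords (m n c d : int) :
  c = 4 /\ d = 0 \/ c = 4 /\ (d = 2 \/ d = -2) \/
    d = 1 /\ (c = 3 \/ c = 1) \/ d = -1 /\ (c = 7 \/ c = 5) ->
  m ^+ 2 - 2 * n ^+ 2 = c -> 2 * m * n + n ^+ 2 = d ->
  n = 0 /\ m ^+ 2 = 4.
Proof.
move=> H h3 h4.
have h5 : n * (2 * m + n) = d by rewrite -h4; ring.
case: H => [[]|[[]|[[]|[]]]].
- move=> hc hd; move/eqP: h5; rewrite hd mulf_eq0 => /orP[/eqP n0|/eqP e].
    by split=> //; rewrite -hc -h3 n0; ring.
  have en : n = - (2 * m) by lia.
  have : 7 * m ^+ 2 = - 4 by rewrite -hc -h3 en; ring.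
  by clear; nia.
- move=> hc hd.
  have hn : -2 <= n <= 2 by apply: (divisor_bounds _ _ _ _ h5) => //; lia.
  have hn' : n = -2 \/ n = -1 \/ n = 0 \/ n = 1 \/ n = 2 by lia.
  by case: hn' => [|[|[|[]]]] ?; subst n; lia.
- move=> hd hc.
  have hn : -1 <= n <= 1 by apply: (divisor_bounds _ _ _ _ h5) => //; lia.
  have hn' : n = -1 \/ n = 0 \/ n = 1 by lia.
  case: hn' => [|[]] e; rewrite e in h5 h3.
  - by have e2 : m = 0; [lia|rewrite e2 in h3; lia].
  - by lia.
  - by have e2 : m = 0; [lia|rewrite e2 in h3; lia].
- move=> hd hc.
  have hn : -1 <= n <= 1 by apply: (divisor_bounds _ _ _ _ h5) => //; lia.
  have hn' : n = -1 \/ n = 0 \/ n = 1 by lia.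
  case: hn' => [|[]] e; rewrite e in h5 h3.
  - by have e2 : m = 1; [lia|rewrite e2 in h3; lia].
  - by lia.
  - by have e2 : m = -1; [lia|rewrite e2 in h3; lia].
Qed.

(* [pr - 2qs] and [ps + qr + qs] are the coordinates of the product of
   [p + q theta] and [r + s theta]; [theta^2 = -2 + theta]. *)
Lemma square_of_factors (p q r s m n e : int) :
  e = 1 \/ e = -1 ->
  p * r - 2 * q * s = - 2 * e -> p * s + q * r + q * s = e ->
  m ^+ 2 - 2 * n ^+ 2 = 4 + p - r -> 2 * m * n + n ^+ 2 = q - s ->
  n = 0 /\ m ^+ 2 = 4.
Proof.
move=> he h1 h2 h3 h4.
(* The product of the two norms is the norm of [e theta^2], so each norm is at most [4]. *)
have hN : (p ^+ 2 + p * q + 2 * q ^+ 2) * (r ^+ 2 + r * s + 2 * s ^+ 2) = 4.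
  transitivity ((p * r - 2 * q * s) ^+ 2
    + (p * r - 2 * q * s) * (p * s + q * r + q * s)
    + 2 * (p * s + q * r + q * s) ^+ 2); first by ring.
  by rewrite h1 h2; case: he => ->.
have [hq hp] : (-1 <= q <= 1) /\ (-2 <= p <= 2).
  have := factor_bounds _ _ _ (norm_ge0 p q) (norm_ge0 r s) hN isT.
  by move=> /andP[_ /norm_le4].
have [hs hr] : (-1 <= s <= 1) /\ (-2 <= r <= 2).
  rewrite mulrC in hN.
  have := factor_bounds _ _ _ (norm_ge0 r s) (norm_ge0 p q) hN isT.
  by move=> /andP[_ /norm_le4].
have hq' : q = -1 \/ q = 0 \/ q = 1 by lia.
have hp' : p = -2 \/ p = -1 \/ p = 0 \/ p = 1 \/ p = 2 by lia.
clear hN hp hq.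
apply: (@square_coords m n (4 + p - r) (q - s)) => //.
(* For fixed [p], [q] and [e] the product equations are linear in [r] and [s]. *)
clear h3 h4; case: hq' => [|[]] hq'; case: hp' => [|[|[|[]]]] hp';
  rewrite hq' hp' in h1 h2 *; case: he => he; rewrite he in h1 h2; lia.
Qed.

(** * Two-by-two matrices through their entries *)

Lemma matrix2P (M N : 'M[algC]_2) :
  M 0 0 = N 0 0 -> M 0 1 = N 0 1 -> M 1 0 = N 1 0 -> M 1 1 = N 1 1 -> M = N.
Proof.
move=> h00 h01 h10 h11; apply/matrixP => i j.
have ord2 (k : 'I_2) : k = 0 \/ k = 1.
  by case: k => [[|[|[]]] hk] //; [left|right]; apply: val_inj.
by case: (ord2 i) => ->; case: (ord2 j) => ->.
Qed.

Lemma mxtrace2 (M : 'M[algC]_2) : \tr M = M 0 0 + M 1 1.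
Proof.
rewrite /mxtrace !big_ord_recl big_ord0 addr0.
by congr (M _ _ + M _ _); apply: val_inj.
Qed.

Lemma mulmx2 (M N : 'M[algC]_2) i j : (M *m N) i j = M i 0 * N 0 j + M i 1 * N 1 j.
Proof.
rewrite mxE !big_ord_recl big_ord0 addr0.
by have -> : lift ord0 ord0 = 1 :> 'I_2 by apply: val_inj.
Qed.

(* [mxE] would also unfold the products into sums. *)
Lemma submx2 (M N : 'M[algC]_2) i j : (M - N) i j = M i j - N i j.
Proof. by rewrite !mxE. Qed.

Lemma det2 (M : 'M[algC]_2) : \det M = M 0 0 * M 1 1 - M 0 1 * M 1 0.
Proof.
rewrite (expand_det_row _ 0) !big_ord_recl big_ord0 addr0 /cofactor !det_mx11 !mxE.
have e1 : lift 0 0 = 1 :> 'I_2 by apply: val_inj.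
have e2 : lift 1 0 = 0 :> 'I_2 by apply: val_inj.
by rewrite !e1 e2 /= expr0 expr1; ring.
Qed.

(** * Matrices over [Z[theta]] and generated groups of determinant one *)

Definition Ztheta_mx (M : 'M[algC]_2) : Prop := forall i j, is_Ztheta (M i j).

Lemma Ztheta_mx_add M N : Ztheta_mx M -> Ztheta_mx N -> Ztheta_mx (M + N).
Proof. by move=> hM hN i j; rewrite mxE; apply: Ztheta_add. Qed.

Lemma Ztheta_mx_opp M : Ztheta_mx M -> Ztheta_mx (- M).
Proof. by move=> hM i j; rewrite mxE; apply: Ztheta_opp. Qed.

Lemma Ztheta_mx_mul M N : Ztheta_mx M -> Ztheta_mx N -> Ztheta_mx (M *m N).
Proof.
by move=> hM hN i j; rewrite mulmx2; apply: Ztheta_add; apply: Ztheta_mul.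
Qed.

Lemma Ztheta_mx_scalar a : is_Ztheta a -> Ztheta_mx a%:M.
Proof.
move=> ha i j; rewrite mxE; case: (i == j); first by rewrite mulr1n.
by rewrite mulr0n; apply: (Ztheta_int 0).
Qed.

Lemma Ztheta_tr M : Ztheta_mx M -> is_Ztheta (\tr M).
Proof. by move=> hM; rewrite mxtrace2; apply: Ztheta_add. Qed.

Lemma Ztheta_det M : Ztheta_mx M -> is_Ztheta (\det M).
Proof.
by move=> hM; rewrite det2; apply: Ztheta_add; [|apply: Ztheta_opp];
  apply: Ztheta_mul.
Qed.

(** Cayley-Hamilton. Inverses become linear in [M], which handles the inverse case of every
    induction on [gen]. *)
Lemma invmx_det1 (M : 'M[algC]_2) : \det M = 1 -> invmx M = (\tr M)%:M - M.
Proof.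
move=> hM.
have uM : M \in unitmx by rewrite unitmxE hM unitr1.
have e : M *m ((\tr M)%:M - M) = 1%:M.
  rewrite -hM det2 mxtrace2.
  by apply: matrix2P; rewrite mulmx2 !mxE /= ?mulr1n ?mulr0n; ring.
by rewrite -[RHS](mulKmx uM) e mulmx1.
Qed.

Lemma gen_Ztheta_det1 (S : 'M[algC]_2 -> Prop) :
  (forall M, S M -> Ztheta_mx M /\ \det M = 1) ->
  forall M, gen S M -> Ztheta_mx M /\ \det M = 1.
Proof.
move=> hS M; elim=> {M} [M /hS //| |M N _ [ZM dM] _ [ZN dN]|M _ [ZM dM]].
- by split; [apply/Ztheta_mx_scalar/(Ztheta_int 1)|rewrite det1].
- by split; [apply: Ztheta_mx_mul|rewrite det_mulmx dM dN mulr1].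
- split; last by rewrite det_inv dM invr1.
  rewrite invmx_det1 //; apply: Ztheta_mx_add; last exact: Ztheta_mx_opp.
  by apply/Ztheta_mx_scalar/Ztheta_tr.
Qed.

(** * Additive commutators *)

Definition comm_mx2 (P Q : 'M[algC]_2) : 'M[algC]_2 := P *m Q - Q *m P.

Lemma comm_mx2C P Q : comm_mx2 P Q = - comm_mx2 Q P.
Proof. by rewrite /comm_mx2 opprB. Qed.

Lemma comm_mx2_mulr P Q R :
  comm_mx2 P (Q *m R) = comm_mx2 P Q *m R + Q *m comm_mx2 P R.
Proof.
by rewrite /comm_mx2 mulmxBl mulmxBr !mulmxA addrA subrK.
Qed.

(** By Cayley-Hamilton for [X], both sides equal [XYX - (tr X) YX + (det X) Y]. *)
Lemma comm_mx2_mulXl X Y :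
  comm_mx2 X Y *m X = ((\tr X)%:M - X) *m comm_mx2 X Y.
Proof.
rewrite mxtrace2 /comm_mx2.
by apply: matrix2P; rewrite ?(mulmx2, submx2) !mxE /= ?mulr1n ?mulr0n; ring.
Qed.

(** In determinant one this is [2 - tr (X Y X^-1 Y^-1)], expanded by Fricke's trace identity. *)
Lemma det_comm_mx2 X Y : \det (comm_mx2 X Y) =
  4 * \det X * \det Y - \tr X ^+ 2 * \det Y - \tr Y ^+ 2 * \det X
  - \tr (X *m Y) ^+ 2 + \tr X * \tr Y * \tr (X *m Y).
Proof.
by rewrite !det2 !mxtrace2 /comm_mx2 !(mulmx2, submx2); ring.
Qed.

(** * The left module [M_2(Z[theta]) C] and its stability under the group *)

Definition left_multiple (C M : 'M[algC]_2) : Prop :=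
  exists R, Ztheta_mx R /\ M = R *m C.

Lemma left_multiple0 C : left_multiple C 0.
Proof.
exists 0; rewrite mul0mx; split=> // i j; rewrite mxE; exact: (Ztheta_int 0).
Qed.

Lemma left_multiple_refl C : left_multiple C C.
Proof.
by exists 1%:M; rewrite mul1mx; split=> //; apply/Ztheta_mx_scalar/(Ztheta_int 1).
Qed.

Lemma left_multiple_add C M N :
  left_multiple C M -> left_multiple C N -> left_multiple C (M + N).
Proof.
move=> [R [ZR ->]] [R' [ZR' ->]]; exists (R + R').
by rewrite mulmxDl; split=> //; apply: Ztheta_mx_add.
Qed.

Lemma left_multiple_opp C M : left_multiple C M -> left_multiple C (- M).
Proof.
move=> [R [ZR ->]]; exists (- R).
by rewrite mulNmx; split=> //; apply: Ztheta_mx_opp.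
Qed.

Lemma left_multiple_mull C M P :
  Ztheta_mx P -> left_multiple C M -> left_multiple C (P *m M).
Proof.
move=> ZP [R [ZR ->]]; exists (P *m R).
by rewrite mulmxA; split=> //; apply: Ztheta_mx_mul.
Qed.

(** Left factors pull out, so only [C Q] matters. By induction on [Q]: in a product, [C M = R C]
    moves [M] past [C]; for an inverse, [C M^-1 = (tr M) C - C M]. *)
Lemma gen_left_multiple_mulr (S : 'M[algC]_2 -> Prop) C :
  (forall M, S M -> Ztheta_mx M /\ \det M = 1) ->
  (forall M, S M -> left_multiple C (C *m M)) ->
  forall Q, gen S Q -> forall M, left_multiple C M -> left_multiple C (M *m Q).
Proof.
move=> hS hC Q gQ M [R [ZR ->]]; rewrite -mulmxA.
apply: left_multiple_mull => // {R ZR M}.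
elim: gQ => {Q} [M /hC //| |M N _ [R [ZR e]] _ hN|M gM hM].
- by rewrite mulmx1; apply: left_multiple_refl.
- by rewrite mulmxA e -mulmxA; apply: left_multiple_mull.
- have [ZM dM] := gen_Ztheta_det1 _ hS _ gM.
  rewrite invmx_det1 // mulmxBr scalar_mxC; apply: left_multiple_add.
    apply: left_multiple_mull (left_multiple_refl _).
    by apply/Ztheta_mx_scalar/Ztheta_tr.
  exact: left_multiple_opp.
Qed.

(** Induction on [Q] by the Leibniz rule, where right stability of the module absorbs the trailing
    factor. For an inverse, the scalar [tr M] commutes with [P], leaving the opposite of the
    commutator with [M]. *)
Lemma gen_left_multiple_comm (S : 'M[algC]_2 -> Prop) C P :
  (forall M, S M -> Ztheta_mx M /\ \det M = 1) ->
  (forall M, S M -> left_multiple C (C *m M)) ->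
  (forall M, S M -> left_multiple C (comm_mx2 P M)) ->
  forall Q, gen S Q -> left_multiple C (comm_mx2 P Q).
Proof.
move=> hS hC hP Q; elim=> {Q} [M /hP //| |M N gM hM gN hN|M gM hM].
- by rewrite /comm_mx2 mulmx1 mul1mx subrr; apply: left_multiple0.
- rewrite comm_mx2_mulr; apply: left_multiple_add.
    exact: gen_left_multiple_mulr hS hC _ gN _ hM.
  by apply: left_multiple_mull => //; have [] := gen_Ztheta_det1 _ hS _ gM.
- have [ZM dM] := gen_Ztheta_det1 _ hS _ gM.
  suff -> : comm_mx2 P (invmx M) = - comm_mx2 P M by apply: left_multiple_opp.
  rewrite invmx_det1 // /comm_mx2 mulmxBr mulmxBl scalar_mxC.
  by rewrite opprB addrC addrA subrK opprB.
Qed.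

Lemma genPSL_comm X Y :
  Ztheta_mx X -> \det X = 1 -> Ztheta_mx Y -> \det Y = 1 ->
  forall P Q, genPSL X Y P -> genPSL X Y Q ->
  left_multiple (comm_mx2 X Y) (comm_mx2 P Q).
Proof.
move=> ZX dX ZY dY P Q gP gQ.
have Ztr1 M : Ztheta_mx M -> Ztheta_mx ((\tr M)%:M - M).
  move=> ZM; apply: Ztheta_mx_add; last exact: Ztheta_mx_opp.
  by apply/Ztheta_mx_scalar/Ztheta_tr.
set C := comm_mx2 X Y.
have hS M : M = X \/ M = Y \/ M = - 1%:M -> Ztheta_mx M /\ \det M = 1.
  case=> [->|[->|->]] //; split.
    by apply/Ztheta_mx_opp/Ztheta_mx_scalar/(Ztheta_int 1).
  by rewrite det2 !mxE /=; ring.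
have hC M : M = X \/ M = Y \/ M = - 1%:M -> left_multiple C (C *m M).
  case=> [->|[->|->]].
  - rewrite comm_mx2_mulXl; apply: left_multiple_mull (left_multiple_refl _).
    exact: Ztr1.
  (* The identity for [X] applies to [Y] as well, since swapping the two only changes the sign of
     [C]. *)
  - rewrite /C comm_mx2C mulNmx comm_mx2_mulXl -mulmxN -comm_mx2C.
    by apply: left_multiple_mull (left_multiple_refl _); apply: Ztr1.
  - by rewrite mulmxN mulmx1; apply/left_multiple_opp/left_multiple_refl.
have commN1 M : left_multiple C (comm_mx2 M (- 1%:M)).
  rewrite /comm_mx2 mulmxN mulNmx mulmx1 mul1mx subrr; exact: left_multiple0.
have commMM M : left_multiple C (comm_mx2 M M).
  rewrite /comm_mx2 subrr; exact: left_multiple0.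
(* Two inductions: commutators of [X] and of [Y] with the whole group come first, and by
   antisymmetry they are the base cases for an arbitrary [P]. *)
have hX := gen_left_multiple_comm _ _ X hS hC.
have hY := gen_left_multiple_comm _ _ Y hS hC.
apply: (gen_left_multiple_comm _ _ P hS hC) gQ => M.
case=> [->|[->|->]] //; rewrite comm_mx2C; apply: left_multiple_opp.
  by apply: hX gP => N [->|[->|->]] //; apply: left_multiple_refl.
apply: hY gP => N [->|[->|->]] //; rewrite comm_mx2C.
by apply/left_multiple_opp/left_multiple_refl.
Qed.

(** * The group [Gamma] and the commutators of its generating pairs *)

Lemma Ztheta_Amat : Ztheta_mx Amat.
Proof.
apply: Ztheta_mx_add; first exact/Ztheta_mx_scalar/(Ztheta_int 1).
by move=> i j; rewrite mxE; case: (_ && _); [apply: (Ztheta_int 1)|apply: (Ztheta_int 0)].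
Qed.

Lemma Ztheta_Bmat : Ztheta_mx Bmat.
Proof.
apply: Ztheta_mx_add; first exact/Ztheta_mx_scalar/(Ztheta_int 1).
move=> i j; rewrite !mxE; apply: Ztheta_mul Ztheta_theta _.
by case: (_ && _); [apply: (Ztheta_int 1)|apply: (Ztheta_int 0)].
Qed.

Lemma det_Amat : \det Amat = 1.
Proof. by rewrite det2 !mxE /=; ring. Qed.

Lemma det_Bmat : \det Bmat = 1.
Proof. by rewrite det2 !mxE /=; ring. Qed.

Lemma det_comm_Amat_Bmat : \det (comm_mx2 Amat Bmat) = - theta ^+ 2.
Proof. by rewrite det2 /comm_mx2 !(mulmx2, submx2) !mxE /=; ring. Qed.

Lemma theta_neq0 : theta != 0.
Proof.
apply/eqP => h; have [] // : (0 : int) = 0 /\ (1 : int) = 0.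
by apply: Ztheta_inj; rewrite h !mulr0.
Qed.

Lemma Gamma_Ztheta_det1 X : Gamma X -> Ztheta_mx X /\ \det X = 1.
Proof.
apply: gen_Ztheta_det1 => M [->|[->|->]].
- by split; [exact: Ztheta_Amat|exact: det_Amat].
- by split; [exact: Ztheta_Bmat|exact: det_Bmat].
- split; last by rewrite det2 !mxE /=; ring.
  by apply/Ztheta_mx_opp/Ztheta_mx_scalar/(Ztheta_int 1).
Qed.

(** Each of the two commutators is an integral left multiple of the other. Taking determinants and
    cancelling [theta^2] makes [det T] a unit of [Z[theta]]. *)
Lemma det_comm_generators X Y : Gamma X -> Gamma Y ->
  (forall M, genPSL X Y M <-> Gamma M) ->
  \det (comm_mx2 X Y) = theta ^+ 2 \/ \det (comm_mx2 X Y) = - theta ^+ 2.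
Proof.
move=> gX gY gXY.
have [ZX dX] := Gamma_Ztheta_det1 _ gX; have [ZY dY] := Gamma_Ztheta_det1 _ gY.
have gA : genPSL X Y Amat by apply/gXY/gen_base; left.
have gB : genPSL X Y Bmat by apply/gXY/gen_base; right; left.
have [R [ZR eR]] := genPSL_comm _ _ ZX dX ZY dY _ _ gA gB.
have [T [ZT eT]] :=
  genPSL_comm _ _ Ztheta_Amat det_Amat Ztheta_Bmat det_Bmat _ _ gX gY.
have dR : - theta ^+ 2 = \det R * \det (comm_mx2 X Y).
  by rewrite -det_comm_Amat_Bmat eR det_mulmx.
have dT : \det (comm_mx2 X Y) = \det T * - theta ^+ 2.
  by rewrite -det_comm_Amat_Bmat -det_mulmx -eT.
have t2 : - theta ^+ 2 != 0 by rewrite oppr_eq0 expf_neq0 ?theta_neq0.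
have : \det T * \det R = 1.
  by apply: (mulIf t2); rewrite mul1r {2}dR dT; ring.
move=> /(Ztheta_unit _ _ (Ztheta_det _ ZT) (Ztheta_det _ ZR)) [] e.
  by right; rewrite dT e mul1r.
by left; rewrite dT e mulN1r opprK.
Qed.

(** * From the determinant of the commutator to the trace *)

Lemma trace_sqr_eq4 x z (e : int) : is_Ztheta x -> is_Ztheta z ->
  e = 1 \/ e = -1 ->
  (z - 2) * (z + 2 - x ^+ 2) = e%:~R * theta ^+ 2 -> x ^+ 2 = 4.
Proof.
move=> Zx Zz he.
have Z2 : is_Ztheta 2 by apply: (Ztheta_int 2).
have [p [q epq]] : is_Ztheta (z - 2) by apply/Ztheta_add/Ztheta_opp.
have [r [s ers]] : is_Ztheta (z + 2 - x ^+ 2).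
  by apply: Ztheta_add; [exact: Ztheta_add|apply/Ztheta_opp/Ztheta_mul].
have ex : x * x = 4 + (z - 2) - (z + 2 - x ^+ 2) by ring.
rewrite epq ers in ex *; case: Zx => m [n em]; rewrite em.
rewrite em Ztheta_mul_coord in ex *; rewrite Ztheta_mul_coord => h.
(* Coordinates are compared using [e theta^2 = - 2e + e theta]. *)
have [h1 h2] : p * r - 2 * q * s = - 2 * e /\ p * s + q * r + q * s = e.
  by apply: Ztheta_inj; rewrite h theta_sqr; ring.
have [h3 h4] : m * m - 2 * n * n = 4 + p - r /\ m * n + n * m + n * n = q - s.
  by apply: Ztheta_inj; rewrite ex; ring.
have [||n0 m2] := square_of_factors p q r s m n e he h1 h2.
- by rewrite -h3; ring.
- by rewrite -h4; ring.
by rewrite n0 mul0r addr0 -rmorphXn m2.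
Qed.

Theorem theorem1p3 (X Y : 'M[algC]_2) :
  Gamma X -> Gamma Y ->
  (forall M, genPSL X Y M <-> Gamma M) ->
  (\tr X = \tr Y \/ \tr X = - \tr Y) ->
  parabolic X /\ parabolic Y.
Proof.
move=> gX gY gXY etr.
have [ZX dX] := Gamma_Ztheta_det1 _ gX; have [ZY dY] := Gamma_Ztheta_det1 _ gY.
have dC := det_comm_generators _ _ gX gY gXY.
(* A central [X] or [Y] would make the commutator vanish; this excludes the identity of [PSL_2]. *)
have C0 : comm_mx2 X Y <> 0.
  move=> h; have t2 := expf_neq0 2 theta_neq0.
  move: dC t2; rewrite h det0 => -[/esym ->|/esym /eqP]; first by rewrite eqxx.
  by rewrite oppr_eq0 => ->.
have nX : (X <> 1%:M /\ X <> - 1%:M) /\ (Y <> 1%:M /\ Y <> - 1%:M).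
  by split; split=> h; apply: C0;
    rewrite /comm_mx2 h ?mulNmx ?mulmxN ?mulmx1 ?mul1mx subrr.
have trY : \tr Y ^+ 2 = \tr X ^+ 2 by case: etr => ->; rewrite ?sqrrN.
suff trX : \tr X ^+ 2 = 4 by case: nX => [[? ?] [? ?]]; rewrite /parabolic trY.
(* The sign is collected in [e], because it is minus the determinant that factors as
   [(z - 2) (z + 2 - x^2)]. *)
have [e he dCe] : exists2 e : int, e = 1 \/ e = -1 &
    - \det (comm_mx2 X Y) = e%:~R * theta ^+ 2.
  case: dC => ->; [exists (-1); [by right|ring]|exists 1; [by left|ring]].
have ZXY := Ztheta_tr _ (Ztheta_mx_mul _ _ ZX ZY).
have ZtX := Ztheta_tr _ ZX.
rewrite det_comm_mx2 dX dY trY in dCe.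
(* Changing the lift of [Y] changes the signs of [tr Y] and [tr XY]. *)
case: etr => etr.
  apply: (trace_sqr_eq4 _ (\tr (X *m Y)) e) => //.
  by rewrite -dCe -etr; ring.
apply: (trace_sqr_eq4 _ (- \tr (X *m Y)) e) => //; first exact: Ztheta_opp.
have -> : - \tr (X *m Y) + 2 - \tr X ^+ 2 = 2 - \tr X ^+ 2 - \tr (X *m Y) by ring.
by rewrite -dCe -[\tr Y]opprK -etr; ring.
Qed.
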